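(* Let $(X,\tau)$ be a locally connected topological space. Then $(X,{}^{*}O(X))$ is locally connected.
   Context: For a topological space $(X,\tau)$, a set $U\subseteq X$ is called regular open if $\mathrm{int}(\mathrm{cl}(U))=U$; the collection of all regular open subsets is denoted $R.O(X)$. A set $A\subseteq X$ is called $*$-open if for every $x\in A$ there exists $U\in R.O(X)$ with $x\in U\subseteq A$. The collection of all $*$-open subsets of $(X,\tau)$ is denoted ${}^{*}O(X)$; it is a topology on $X$. A space is locally connected if for every point $x$ and every open set $U$ containing $x$ there is a connected open set $W$ with $x\in W\subseteq U$. *)

(* Defs.v *)
From HB Require Import structures.
From mathcomp Require Import all_boot all_classical.
From mathcomp Require Import topology.

Set Implicit Arguments.
Unset Strict Implicit.
Unset Printing Implicit Defensive.

Local Open Scope classical_set_scope.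

Definition star_open (X : topologicalType) : set_system X :=
  [set A | forall x, A x -> exists U : set X, [/\ regopen U, U x & U `<=` A]].

(* Alias of X carrying the topology of star_open sets of X; the carrier is
   convertible to X, so the type selects which of the two topologies is meant. *)
Definition star_topology (X : topologicalType) : Type := X.

Section StarTopology.
Variable X : topologicalType.

Lemma regopenT : regopen [set: X].
Proof. by rewrite /regopen closureT interiorT. Qed.

Lemma regopenI : setI_closed (@regopen X).
Proof.
move=> A B rA rB; rewrite /regopen eqEsubset; split.
  rewrite subsetI -{2}rA -{3}rB.
  by split; apply/interiorS/closureS => x -[].
have oA : open A by rewrite -rA; exact: open_interior.
have oB : open B by rewrite -rB; exact: open_interior.
rewrite -open_subsetE; last exact: openI.
exact: subset_closure.
Qed.

Lemma star_openT : star_open [set: X].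
Proof. by move=> x _; exists setT; split=> //; exact: regopenT. Qed.

Lemma star_openI : setI_closed (@star_open X).
Proof.
move=> A B oA oB x [/oA[U [rU Ux UA]] /oB[V [rV Vx VB]]].
by exists (U `&` V); split=> //; [exact: regopenI | exact: setISS].
Qed.

Lemma star_open_bigU (I : Type) (f : I -> set X) :
  (forall i, star_open (f i)) -> star_open (\bigcup_i f i).
Proof.
move=> of_ x [i _ /of_[U [rU Ux Uf]]]; exists U; split=> //.
by move=> y /Uf fy; exists i.
Qed.

HB.instance Definition _ := Choice.copy (star_topology X) X.
HB.instance Definition _ := isOpenTopological.Build (star_topology X)
  star_openT star_openI star_open_bigU.

Lemma star_topology_openE : @open (star_topology X) = @star_open X.
Proof. by []. Qed.

End StarTopology.

Definition locally_connected (X : topologicalType) :=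
  forall (x : X) (U : set X), open U -> U x ->
    exists W : set X, [/\ open W, connected W, W x & W `<=` U].

(* Main.v *)
(** Regular open sets form a base of the new topology.  If [x] lies in a regular
    open [U], take a connected open [W] with [x \in W] and [W] inside [U]; then
    [int (cl W)] is regular open, contains [W], stays inside [int (cl U) = U],
    and is connected because it lies between [W] and [cl W].  Since the new
    topology is coarser than the original one, it remains connected there. *)
Require Import Defs.
From mathcomp Require Import all_boot all_classical.
From mathcomp Require Import topology.

Local Open Scope classical_set_scope.

(** A nonempty clopen part [E] of [B] meets [A], since its open witness [C] is a neighbourhood of a
    point of [closure A]. Hence [E] contains [A], and its closed witness [D] contains
    [closure A]. *)
Lemma connected_between_closure (T : topologicalType) (A B : set T) :
  connected A -> A `<=` B -> B `<=` closure A -> connected B.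
Proof.
move=> cA AB BclA E [e Ee] [C oC EC] [D cD ED].
have ACD : A `&` C = A `&` D.
  rewrite eqEsubset; split=> y [Ay y_in]; split=> //.
    have : E y by rewrite EC; split=> //; exact: AB.
    by rewrite ED => -[].
  have : E y by rewrite ED; split=> //; exact: AB.
  by rewrite EC => -[].
have AC_A : A `&` C = A.
  apply: cA; [|by exists C|by exists D].
  move: Ee; rewrite EC => -[/BclA clAe Ce].
  exact: clAe (open_nbhs_nbhs (conj oC Ce)).
rewrite ED; apply/setIidPl; apply: (subset_trans BclA).
by rewrite (closure_id D).1//; apply: closureS; rewrite -AC_A ACD => y [].
Qed.

Lemma star_open_open (X : topologicalType) (A : set X) : star_open A -> open A.
Proof.
move=> sA; rewrite openE => x /sA[U [rU Ux UA]].
have oU : open U by rewrite -rU; exact: open_interior.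
by move: UA; rewrite open_subsetE// => /(_ _ Ux).
Qed.

Lemma star_connected (X : topologicalType) (A : set X) :
  connected A -> @connected (star_topology X) A.
Proof.
move=> cA B B0 [C oC BC] [D cD BD]; apply: cA => //.
  by exists C => //; exact: star_open_open.
(* Closedness passes through the complement: the first [openC] is for [X], the second for
   [star_topology X]. *)
exists D => //; rewrite -openC; apply: star_open_open.
by rewrite -star_topology_openE openC.
Qed.

Lemma regopen_star_open (X : topologicalType) (U : set X) :
  regopen U -> star_open U.
Proof. by move=> rU x Ux; exists U; split. Qed.

Theorem lemma21 (X : topologicalType) (hX : locally_connected X) :
  locally_connected (star_topology X).
Proof.
move=> x A oA Ax.
have [U [rU Ux UA]] : exists U : set X, [/\ regopen U, U x & U `<=` A].
  (* [oA] is convertible to [star_open A]. *)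
  exact: oA.
have oU : open U by rewrite -rU; exact: open_interior.
have [W [oW cW Wx WU]] := hX x U oU Ux.
have WV : W `<=` (closure W)°.
  by rewrite -open_subsetE//; exact: subset_closure.
exists ((closure W)°); split.
- apply: regopen_star_open; apply: interior_closed_regopen.
  exact: closed_closure.
- apply: star_connected; apply: connected_between_closure cW WV _.
  exact: interior_subset.
- exact: WV.
- by apply: subset_trans UA; rewrite -rU; apply/interiorS/closureS.
Qed.
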